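(* Let $d\ge 1$, let $U\subset\mathbb{R}^{d}$ be open and convex, let $f\in C^{1}(U;\mathbb{R}^{d})$ with Jacobian $J_f$, let $x_n\in U$, and let $M(x_n)\in\mathbb{R}^{d\times d}$ be an invertible matrix. Put $\alpha_n:=\|M(x_n)^{-1}f(x_n)\|$. Assume that there are constants $\omega^{\star}>0$ and $\kappa^{\star}<1$ such that: (A$^\star$1) for all $x,v\in U$ and every $t\in[0,1]$, with $z:=t x+(1-t)v$, $$\|M(x_n)^{-1}(J_f(x)-J_f(z))(x-v)\|\le \omega^{\star}(1-t)\|x-v\|^{2};$$ (A$^\star$2) for every $x\in U$, $\|\mathrm{Id}-M(x_n)^{-1}J_f(x)\|\le\kappa^{\star}<1$; (A$^\star$3) $\alpha_n>0$ and $\omega^{\star}\alpha_n\le \frac{(1-\kappa^{\star})^2}{2}$; (A$^\star$4) for $$R^{\star}:=\frac{1-\kappa^{\star}}{\omega^{\star}}+\sqrt{\frac{(1-\kappa^{\star})^2}{(\omega^{\star})^2}-\frac{2\alpha_n}{\omega^{\star}}}$$ one has $B_{R^{\star}}(x_n)\subset U$. Then the simplified Newton-like iterates defined by $$u_n:=x_n,\qquad u_{j+1}:=u_j-M(x_n)^{-1}f(u_j),\quad j\ge n,$$ are well defined, remain in $B_{R^{\star}}(x_n)$, and converge as $j\to\infty$ to a point $u_\infty\in B_{R^{\star}}(x_n)$ which is the unique zero of $f$ in $B_{R^{\star}}(x_n)$.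
   Context: $\|x\|$ is the Euclidean norm on $\mathbb{R}^d$, and for a matrix $M$, $\|M\|:=\sup_{\|x\|=1}\|Mx\|$ is the operator norm. $B_R(x)$ denotes the closed ball of radius $R$ centered at $x$. $\mathrm{Id}$ is the identity matrix. The subscript $n$ in $x_n$ is only a fixed nonnegative integer index (in the source, $x_n$ is an iterate of the damped scheme $x_{j+1}=x_j-t_jM(x_j)^{-1}f(x_j)$, $t_j\in(0,1]$, started at some $x_0\in U$, where $x\mapsto M(x)$ is a matrix-valued map on $U$); the dimension is denoted $d$. *)

(* Defs.v *)
From HB Require Import structures.
From mathcomp Require Export all_boot all_order all_algebra.
From mathcomp Require Export all_classical all_reals all_analysis.
Export Order.TTheory GRing.Theory Num.Theory.
Export numFieldNormedType.Exports.

Set Implicit Arguments.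
Unset Strict Implicit.
Unset Printing Implicit Defensive.

Local Open Scope classical_set_scope.
Local Open Scope ring_scope.

(* Vectors of R^d are column vectors.  The topology MathComp-Analysis puts on
   'cV[R]_d is the usual product topology, but its built-in norm `|x| is the
   sup norm, hence the Euclidean norm below. *)
Definition enorm (R : realType) (d : nat) (x : 'cV[R]_d) : R :=
  Num.sqrt (\sum_(i < d) x i ord0 ^+ 2).

(* For 0 < d the set is nonempty and bounded, so this is a genuine supremum. *)
Definition opnorm (R : realType) (d : nat) (A : 'M[R]_d) : R :=
  sup [set enorm (A *m x) | x in [set x : 'cV[R]_d | enorm x = 1]].

Definition eclosed_ball (R : realType) (d : nat) (x : 'cV[R]_d) (r : R) :
    set 'cV[R]_d :=
  [set y | enorm (y - x) <= r].

(* The library's jacobian is for row vectors, acting on the right; this one has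
   entries (i, j) = d f_i / d x_j and acts on column vectors on the left. *)
Definition jacobian_col (R : realType) (d : nat) (f : 'cV[R]_d -> 'cV[R]_d)
    (x : 'cV[R]_d) : 'M[R]_d :=
  \matrix_(i < d, j < d)
    'D_(delta_mx j ord0) (fun y : 'cV[R]_d => f y i ord0 : R) x.

(* Meant for U open: then only the values of f on U matter. *)
Definition C1_on (R : realType) (d : nat) (U : set 'cV[R]_d)
    (f : 'cV[R]_d -> 'cV[R]_d) : Prop :=
  (forall x, U x -> differentiable f x) /\
  {in U, continuous (jacobian_col f)}.

(* The iterates u_n = xn, u_(j+1) = u_j - M^-1 f(u_j) for j >= n; indices
   j < n carry the dummy value xn.  As f is total here, that the iterates
   are well defined means that every u_j with j >= n lies in the domain of f. *)
Definition simplified_newton (R : realType) (d : nat)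
    (f : 'cV[R]_d -> 'cV[R]_d) (M : 'M[R]_d) (xn : 'cV[R]_d) (n j : nat) :
    'cV[R]_d :=
  iter (j - n) (fun u => u - invmx M *m f u) xn.

Lemma simplified_newton_start (R : realType) (d : nat)
    (f : 'cV[R]_d -> 'cV[R]_d) (M : 'M[R]_d) (xn : 'cV[R]_d) (n : nat) :
  simplified_newton f M xn n n = xn.
Proof. by rewrite /simplified_newton subnn. Qed.

Lemma simplified_newton_step (R : realType) (d : nat)
    (f : 'cV[R]_d -> 'cV[R]_d) (M : 'M[R]_d) (xn : 'cV[R]_d) (n j : nat) :
  (n <= j)%N ->
  simplified_newton f M xn n j.+1 =
  simplified_newton f M xn n j - invmx M *m f (simplified_newton f M xn n j).
Proof. by move=> nj; rewrite /simplified_newton subSn. Qed.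

(* Main.v *)
(* Since U is convex, (A*2) and the mean value inequality make the step map
   T x = x - M^-1 f(x) a kappa-contraction on U, whose fixed points are the
   zeros of f.  By (A*3), R* >= (1 - kappa) / omega >= 2 alpha / (1 - kappa),
   so that kappa R* + alpha <= R* and T maps the closed ball into itself. *)

Require Import Defs.
From mathcomp Require Import ring lra.

Set Implicit Arguments.
Unset Strict Implicit.
Unset Printing Implicit Defensive.

Local Open Scope classical_set_scope.
Local Open Scope ring_scope.

(** * Euclidean norm, inner product and operator norm *)

Section Euclidean.
Context {R : realType} {d : nat}.
Implicit Types (x y w h : 'cV[R]_d) (A : 'M[R]_d).

Definition edot x y : R := \sum_(i < d) x i ord0 * y i ord0.

Lemma enorm_ge0 x : 0 <= enorm x.
Proof. exact: sqrtr_ge0. Qed.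

Lemma enorm_sqr x : enorm x ^+ 2 = \sum_(i < d) x i ord0 ^+ 2.
Proof. by rewrite sqr_sqrtr// sumr_ge0// => i _; exact: sqr_ge0. Qed.

Lemma enorm_sqr_edot x : enorm x ^+ 2 = edot x x.
Proof. by rewrite enorm_sqr; apply: eq_bigr => i _; rewrite expr2. Qed.

Lemma enorm_le x r : 0 <= r -> enorm x ^+ 2 <= r ^+ 2 -> enorm x <= r.
Proof. by move=> r0; rewrite ler_sqr ?nnegrE ?enorm_ge0. Qed.

Lemma entry_le_enorm x i : `|x i ord0| <= enorm x.
Proof.
rewrite -ler_sqr ?nnegrE ?enorm_ge0// enorm_sqr real_normK ?num_real//.
by rewrite (bigD1 i)//= lerDl sumr_ge0// => j _; exact: sqr_ge0.
Qed.

Lemma enorm_eq0 x : enorm x = 0 -> x = 0.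
Proof.
move=> x0; apply/matrixP => i j; rewrite ord1 mxE; apply/eqP.
by rewrite -normr_le0 -x0 entry_le_enorm.
Qed.

Lemma enorm0 : enorm (0 : 'cV[R]_d) = 0.
Proof.
by rewrite /enorm big1 ?sqrtr0// => i _; rewrite mxE expr0n.
Qed.

Lemma enormZ (a : R) x : enorm (a *: x) = `|a| * enorm x.
Proof.
apply: (@pexpIrn _ 2) => //; rewrite ?nnegrE ?mulr_ge0 ?enorm_ge0//.
rewrite exprMn real_normK ?num_real// !enorm_sqr mulr_sumr.
by apply: eq_bigr => i _; rewrite mxE exprMn.
Qed.

Lemma enormN x : enorm (- x) = enorm x.
Proof. by rewrite -scaleN1r enormZ normrN1 mul1r. Qed.

Lemma enorm_distC x y : enorm (x - y) = enorm (y - x).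
Proof. by rewrite -enormN opprB. Qed.

(** Cauchy-Schwarz: the squared norm of [enorm y *: x - enorm x *: y] is nonnegative and factors as
    below; nonzero norms allow division by the first factor. *)
Lemma edot_le_enorm x y : edot x y <= enorm x * enorm y.
Proof.
have [x0|x0] := eqVneq (enorm x) 0.
  by rewrite x0 mul0r (enorm_eq0 x0) /edot big1// => i _; rewrite mxE mul0r.
have [y0|y0] := eqVneq (enorm y) 0.
  by rewrite y0 mulr0 (enorm_eq0 y0) /edot big1// => i _; rewrite mxE mulr0.
have xy_gt0 : 0 < enorm x * enorm y.
  by rewrite mulr_gt0// lt_neqAle eq_sym ?x0 ?y0 enorm_ge0.
have : 0 <= \sum_(i < d) (enorm y * x i ord0 - enorm x * y i ord0) ^+ 2.
  by rewrite sumr_ge0// => i _; exact: sqr_ge0.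
have -> : \sum_(i < d) (enorm y * x i ord0 - enorm x * y i ord0) ^+ 2
    = 2 * (enorm x * enorm y) * (enorm x * enorm y - edot x y).
  transitivity (enorm y ^+ 2 * (\sum_(i < d) x i ord0 ^+ 2)
      - 2 * (enorm x * enorm y) * edot x y
      + enorm x ^+ 2 * (\sum_(i < d) y i ord0 ^+ 2)); last first.
    by rewrite -!enorm_sqr; ring.
  rewrite !mulr_sumr -sumrB -big_split/=.
  by apply: eq_bigr => i _; ring.
by rewrite pmulr_rge0 ?subr_ge0// mulr_gt0.
Qed.

Lemma edotDr w x y : edot w (x + y) = edot w x + edot w y.
Proof.
by rewrite /edot -big_split/=; apply: eq_bigr => i _; rewrite mxE mulrDr.
Qed.

Lemma edotNr w x : edot w (- x) = - edot w x.
Proof.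
by rewrite /edot -sumrN; apply: eq_bigr => i _; rewrite mxE mulrN.
Qed.

Lemma edotC x y : edot x y = edot y x.
Proof. by apply: eq_bigr => i _; rewrite mulrC. Qed.

Lemma enormD x y : enorm (x + y) <= enorm x + enorm y.
Proof.
apply: enorm_le; first by rewrite addr_ge0 ?enorm_ge0.
have := edot_le_enorm x y.
rewrite sqrrD !enorm_sqr_edot edotDr [edot (x + y) x]edotC.
rewrite [edot (x + y) y]edotC !edotDr [edot y x]edotC.
lra.
Qed.

(** Cauchy-Schwarz on each row makes the Frobenius norm a valid [C]. This bounds the set whose [sup]
    is [opnorm A]. *)
Lemma enorm_mulmx_bounded A :
  exists C : R, forall x, enorm (A *m x) <= C * enorm x.
Proof.
exists (Num.sqrt (\sum_(i < d) enorm (row i A)^T ^+ 2)) => x.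
apply: enorm_le; first by rewrite mulr_ge0 ?sqrtr_ge0 ?enorm_ge0.
rewrite (enorm_sqr (A *m x)) exprMn sqr_sqrtr; last by apply: sumr_ge0 => i _; exact: sqr_ge0.
rewrite mulr_suml; apply: ler_sum => i _.
have -> : (A *m x) i ord0 = edot (row i A)^T x.
  by rewrite mxE; apply: eq_bigr => j _; rewrite !mxE.
rewrite -exprMn -[X in X <= _]real_normK ?num_real// ler_sqr ?nnegrE//; last first.
  by rewrite mulr_ge0 ?enorm_ge0.
rewrite ler_norml edot_le_enorm andbT lerNl -edotNr.
by rewrite -(enormN x) edot_le_enorm.
Qed.

Lemma enorm_mulmx_le_opnorm A x : enorm (A *m x) <= opnorm A * enorm x.
Proof.
have [/enorm_eq0 ->|x0] := eqVneq (enorm x) 0.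
  by rewrite mulmx0 enorm0 mulr0.
have x_gt0 : 0 < enorm x by rewrite lt_neqAle eq_sym x0 enorm_ge0.
(* Rescaling [x] to a unit vector puts the quotient into the set defining [opnorm A]. *)
rewrite -ler_pdivrMr// mulrC -[(enorm x)^-1]ger0_norm ?invr_ge0 ?enorm_ge0//.
rewrite -enormZ scalemxAr; apply: ub_le_sup.
  have [C AC] := enorm_mulmx_bounded A.
  by exists C => _ [y y1 <-]; rewrite (le_trans (AC y))// y1 mulr1.
exists ((enorm x)^-1 *: x) => //=.
by rewrite enormZ ger0_norm ?invr_ge0 ?enorm_ge0// mulVf.
Qed.

(** When [0 < d] the all-ones vector is nonzero, and [opnorm A] times its norm dominates a norm. *)
Lemma opnorm_ge0 A : (0 < d)%N -> 0 <= opnorm A.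
Proof.
move=> d0; pose e : 'cV[R]_d := const_mx 1.
have e_gt0 : 0 < enorm e.
  apply: lt_le_trans (entry_le_enorm e (Ordinal d0)).
  by rewrite mxE normr1.
rewrite -(pmulr_lge0 _ e_gt0); apply: le_trans (enorm_mulmx_le_opnorm A e).
exact: enorm_ge0.
Qed.

(** * Convergence of sequences of vectors *)

Lemma enorm_continuous : continuous (@enorm R d).
Proof.
move=> x; apply: (@continuous_comp _ _ _ _ Num.sqrt); last exact: sqrt_continuous.
apply: continuous_big; first exact: add_continuous.
move=> i _ y.
apply: (@continuous_comp _ _ _ (fun z : 'cV[R]_d => z i ord0 : R) (fun a => a ^+ 2)).
  exact: coord_continuous.
exact: exprn_continuous.
Qed.

Lemma cvg_enorm_dist (u : nat -> 'cV[R]_d) x :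
  u @ \oo --> x -> enorm (u k - x) @[k --> \oo] --> (0 : R).
Proof.
move=> ux; rewrite -enorm0.
apply: continuous_cvg; first exact: enorm_continuous.
by rewrite -(subrr x); apply: cvgB => //; exact: cvg_cst.
Qed.

(** Entries are bounded by the Euclidean norm, so each entry of [u] is, up to a constant, a
    telescoping series dominated by a geometric one. The limit is assembled entrywise. *)
Lemma geometric_increments_cvg (u : nat -> 'cV[R]_d) (a q : R) :
  0 <= q -> q < 1 -> (forall k, enorm (u k.+1 - u k) <= a * q ^+ k) ->
  exists x, u @ \oo --> x.
Proof.
move=> q0 q1 uaq.
have ucvg (i : 'I_d) : cvgn (fun k => u k i ord0).
  pose v k : R := u k i ord0.
  suff sv : cvgn (series (telescope v)).
    rewrite -/v; rewrite [v](_ : _ = fun k => v 0%N + series (telescope v) k).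
      by apply: is_cvgD => //; exact: is_cvg_cst.
    by apply/funext => k; rewrite -eq_sum_telescope.
  apply: (@normed_cvg _ R^o).
  apply: (@series_le_cvg _ _ (geometric a q)).
  - by move=> k /=.
  - by move=> k /=; exact: le_trans (enorm_ge0 _) (uaq k).
  - move=> k /=; apply: le_trans (uaq k).
    by apply: le_trans (entry_le_enorm _ i); rewrite !mxE.
  - by apply: is_cvg_geometric_series; rewrite ger0_norm.
exists (\col_i limn (fun k => u k i ord0)).
apply/cvgrPdist_le => /= e e0; near=> k.
(* The topology is that of the sup norm, so finitely many entrywise estimates suffice. *)
rewrite /Num.Def.normr/= mx_normrE (bigmax_le _ (ltW e0))//= => -[i j] _ /=.
rewrite !mxE (ord1 j) {j}; move: i; near: k; apply: filter_forall => i.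
by move: (ucvg i) => /cvgrPdist_le/(_ _ e0).
Unshelve. all: by end_near. Qed.

(** * Derivatives along lines and the mean value inequality *)

Lemma differentiable_entry (f : 'cV[R]_d -> 'cV[R]_d) x i :
  differentiable f x -> differentiable (fun y => f y i ord0 : R) x.
Proof.
move=> fx; apply: (@differentiable_comp _ _ _ _ f (fun y => y i ord0 : R)) => //.
exact: differentiable_coord.
Qed.

Lemma jacobian_colE (f : 'cV[R]_d -> 'cV[R]_d) x h i : differentiable f x ->
  'D_h (fun y => f y i ord0 : R) x = (jacobian_col f x *m h) i ord0.
Proof.
move=> fx; have fxi := differentiable_entry i fx.
rewrite deriveE// [X in 'd _ x X](_ : h = \sum_(j < d) h j ord0 *: delta_mx j ord0).
  rewrite linear_sum mxE; apply: eq_bigr => j _.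
  by rewrite linearZ mxE deriveE// mulrC.
by rewrite [LHS]matrix_sum_delta; apply: eq_bigr => j _; rewrite big_ord1.
Qed.

(** The difference quotients in [t] are exactly those of the directional derivative along [h] at
    [s *: h + y]. *)
Lemma is_derive_line (f : 'cV[R]_d -> 'cV[R]_d) y h s i :
  differentiable f (s *: h + y) ->
  is_derive s 1 (fun t => f (t *: h + y) i ord0 : R)
    ((jacobian_col f (s *: h + y) *m h) i ord0).
Proof.
move=> fs; rewrite -jacobian_colE//.
have E : (fun r => r^-1 *: ((f ((r *: (1 : R) + s) *: h + y) i ord0 : R)
      - f (s *: h + y) i ord0)) =
    (fun r => r^-1 *: ((f (r *: h + (s *: h + y)) i ord0 : R)
      - f (s *: h + y) i ord0)).
  by apply/funext => r; rewrite addrA -scalerDl [r%:A]mulr1.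
have fi : derivable (fun z => f z i ord0 : R) (s *: h + y) h.
  exact/diff_derivable/differentiable_entry.
by split; rewrite /derivable /derive E.
Qed.

Lemma enorm_mean_value (p dp : R -> 'cV[R]_d) (K : R) :
  (forall (s : R) i, 0 <= s <= 1 ->
     is_derive s 1 (fun t => p t i ord0 : R) (dp s i ord0)) ->
  (forall s : R, 0 <= s <= 1 -> enorm (dp s) <= K) ->
  enorm (p 1 - p 0) <= K.
Proof.
(* The scalar mean value theorem applies to the component of p along w. *)
move=> pdp dpK; set w := p 1 - p 0.
have [w0|w0] := eqVneq (enorm w) 0.
  by rewrite w0 (le_trans (enorm_ge0 (dp 0)))// dpK// lexx ler01.
have w_gt0 : 0 < enorm w by rewrite lt_neqAle eq_sym w0 enorm_ge0.
have wp (s : R) : 0 <= s <= 1 -> is_derive s 1 (fun t => edot w (p t)) (edot w (dp s)).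
  move=> s01.
  have -> : (fun t => edot w (p t))
      = \sum_(i < d) (w i ord0 \*: (fun t => p t i ord0 : R)).
    by apply/funext => t; rewrite fct_sumE.
  apply: is_derive_sum => i; apply: is_deriveZ; exact: pdp.
have [//|s||c c01 /eqP] := @MVT R (fun t => edot w (p t)) (fun s => edot w (dp s)) 0 1.
- by rewrite in_itv/= => /andP[s0 s1]; apply: wp; rewrite !ltW.
- apply: derivable_within_continuous => s; rewrite in_itv/= => s01.
  by case: (wp s s01).
rewrite subr0 mulr1 -edotNr -edotDr -/w -enorm_sqr_edot => /eqP wc.
(* At the intermediate point, [enorm w ^+ 2 = edot w (dp c)], which is at most [enorm w * K]; the
   factor [enorm w] cancels. *)
rewrite -(ler_pM2l w_gt0) -expr2 wc (le_trans (edot_le_enorm _ _))//.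
rewrite ler_pM2l// dpK//; move: c01.
by rewrite in_itv/= => /andP[c0 c1]; rewrite !ltW.
Qed.

End Euclidean.

(** On the segment from [y] to [x] the step map has derivative
    [(1%:M - B *m jacobian_col f (z t)) *m h] with [h = x - y], of norm at most
    [kappa * enorm h]. *)
Lemma newton_step_lipschitz (R : realType) (d : nat) (U : set 'cV[R]_d)
    (f : 'cV[R]_d -> 'cV[R]_d) (B : 'M[R]_d) (kappa : R) :
  convex_set U -> (forall x, U x -> differentiable f x) ->
  (forall x, U x -> opnorm (1%:M - B *m jacobian_col f x) <= kappa) ->
  forall x y, U x -> U y ->
    enorm ((x - B *m f x) - (y - B *m f y)) <= kappa * enorm (x - y).
Proof.
move=> Ucvx fU fkappa x y Ux Uy.
have [h hE] : exists h, h = x - y by exists (x - y).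
pose T (z : 'cV[R]_d) : 'cV[R]_d := z - B *m f z.
pose z (t : R) : 'cV[R]_d := t *: h + y.
have Uz t : 0 <= t <= 1 -> U (z t).
  move=> /andP[t0 t1].
  have t01 : Itv.spec (@Itv.num_sem R) (Itv.Real `[0%Z, 1%Z]) t.
    by rewrite /= /Itv.num_sem/= num_real/= in_itv/= t0.
  have /set_mem := @Ucvx x y (Itv.mk t01) (mem_set Ux) (mem_set Uy).
  by congr (U _); rewrite /z hE /conv/= scalerBl scale1r scalerBr addrCA addrC.
rewrite -hE; have -> : (x - B *m f x) - (y - B *m f y) = T (z 1) - T (z 0).
  by rewrite /z scale1r scale0r add0r hE subrK.
apply: (@enorm_mean_value R d (T \o z)
  (fun t => (1%:M - B *m jacobian_col f (z t)) *m h)).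
- move=> t i t01; rewrite mulmxBl mul1mx.
  (* Entry [i] is an affine function of [s] minus a linear combination of entries of [f] on the
     line, a form to which the differentiation rules apply termwise. *)
  have -> : (fun s => (T \o z) s i ord0 : R) =
      (h i ord0 \*: (id : R -> R) + cst (y i ord0))
      - \sum_(j < d) (B i j \*: (fun s => f (s *: h + y) j ord0 : R)).
    apply/funext => s; rewrite -[RHS]/(h i ord0 * s + y i ord0 - _ s) fct_sumE.
    by rewrite /= !mxE mulrC.
  have -> : (h - B *m jacobian_col f (z t) *m h) i ord0 = h i ord0 *: 1 + 0
      - \sum_(j < d) B i j *: (jacobian_col f (z t) *m h) j ord0.
    by rewrite -mulmxA !mxE addr0 [_%:A]mulr1.
  apply: is_deriveB; apply: is_derive_sum => j; apply: is_deriveZ.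
  by apply: is_derive_line; exact/fU/Uz.
- move=> t t01; apply: le_trans (enorm_mulmx_le_opnorm _ _) _.
  by apply: ler_wpM2r; [exact: enorm_ge0 | exact/fkappa/Uz].
Qed.

Theorem corollary2p4 (R : realType) (d : nat) (d_ge1 : (1 <= d)%N)
  (U : set 'cV[R]_d) (U_open : open U) (U_convex : convex_set U)
  (f : 'cV[R]_d -> 'cV[R]_d) (f_C1 : C1_on U f)
  (n : nat) (xn : 'cV[R]_d) (xn_U : U xn)
  (M : 'M[R]_d) (M_inv : M \in unitmx)
  (omega kappa : R) (omega_gt0 : 0 < omega) (kappa_lt1 : kappa < 1) :
  let alpha := enorm (invmx M *m f xn) in
  let Rstar := (1 - kappa) / omega
    + Num.sqrt ((1 - kappa) ^+ 2 / omega ^+ 2 - 2 * alpha / omega) in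
  (forall (x v : 'cV[R]_d) (t : R), U x -> U v -> 0 <= t -> t <= 1 ->
    let z := t *: x + (1 - t) *: v in
    enorm (invmx M *m (jacobian_col f x - jacobian_col f z) *m (x - v))
      <= omega * (1 - t) * enorm (x - v) ^+ 2) ->
  (forall x : 'cV[R]_d, U x ->
    opnorm (1%:M - invmx M *m jacobian_col f x) <= kappa) ->
  0 < alpha -> omega * alpha <= (1 - kappa) ^+ 2 / 2 ->
  eclosed_ball xn Rstar `<=` U ->
  let u := simplified_newton f M xn n in
  (forall j, (n <= j)%N -> U (u j) /\ eclosed_ball xn Rstar (u j)) /\
  exists u_oo : 'cV[R]_d,
    [/\ eclosed_ball xn Rstar u_oo,
        u @ \oo --> u_oo,
        f u_oo = 0 &
        forall y : 'cV[R]_d, eclosed_ball xn Rstar y -> f y = 0 -> y = u_oo].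
Proof.
move=> alpha Rstar _ Hkappa alpha_gt0 Halpha ball_U u.
pose T (x : 'cV[R]_d) : 'cV[R]_d := x - invmx M *m f x.
have Tlip : forall x y, U x -> U y -> enorm (T x - T y) <= kappa * enorm (x - y).
  by apply: newton_step_lipschitz => // x Ux; exact: f_C1.1.
have kappa_ge0 : 0 <= kappa := le_trans (opnorm_ge0 _ d_ge1) (Hkappa _ xn_U).
have Rstar_ge0 : 0 <= Rstar.
  by rewrite addr_ge0 ?sqrtr_ge0// divr_ge0 ?subr_ge0 ?ltW.
have alphaR : alpha <= (1 - kappa) * Rstar.
  (* The first summand of [Rstar] suffices, even after weakening the bound on [omega * alpha] by a
     factor 2. *)
  apply: (@le_trans _ _ ((1 - kappa) * ((1 - kappa) / omega))).
    rewrite mulrA ler_pdivlMr// -expr2 mulrC (le_trans Halpha)//.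
    by rewrite ler_pdivrMr// ler_peMr ?sqr_ge0// ler1n.
  by rewrite ler_pM2l ?subr_gt0// lerDl sqrtr_ge0.
have Txn : enorm (T xn - xn) = alpha by rewrite /T addrAC subrr add0r enormN.
have xn_ball : eclosed_ball xn Rstar xn by rewrite /eclosed_ball/= subrr enorm0.
have ballT x : eclosed_ball xn Rstar x -> eclosed_ball xn Rstar (T x).
  move=> Bx; rewrite /eclosed_ball/= -(subrKA (T xn)).
  apply: le_trans (enormD _ _) _; rewrite Txn.
  have := Tlip _ _ (ball_U _ Bx) xn_U.
  have : kappa * enorm (x - xn) <= kappa * Rstar by rewrite ler_wpM2l.
  lra.
(* [v] is [u] reindexed to start at 0: [v k = u (k + n)]. *)
pose v (k : nat) : 'cV[R]_d := iter k T xn.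
have vball k : eclosed_ball xn Rstar (v k) by elim: k => //= k; exact: ballT.
split=> [j nj|].
  by have Bj := vball (j - n)%N; split => //; exact: ball_U.
have [l vl] : exists l : 'cV[R]_d, v @ \oo --> l.
  (* The first increment has norm [alpha], and each application of [T] contracts by [kappa]. *)
  apply: (@geometric_increments_cvg _ _ v alpha kappa) => // k.
  elim: k => [|k IH]; first by rewrite expr0 mulr1 -Txn.
  have := Tlip _ _ (ball_U _ (vball k.+1)) (ball_U _ (vball k)).
  move/le_trans; apply.
  by rewrite exprS mulrCA ler_wpM2l.
have vl0 := cvg_enorm_dist vl.
have Bl : eclosed_ball xn Rstar l.
  rewrite /eclosed_ball/=.
  (* The ball is closed: [enorm (l - xn)] is at most [enorm (v k - l) + Rstar] for every [k]. *)
  have : enorm (v k - l) + Rstar @[k --> \oo] --> 0 + Rstar.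
    by apply: cvgD => //; exact: cvg_cst.
  rewrite add0r => cvgR.
  apply: (cvgr_to_ge cvgR).
  near=> k; rewrite -(subrKA (v k)); apply: le_trans (enormD _ _) _.
  by rewrite lerD ?vball// enorm_distC.
have Tl : T l = l.
  apply/eqP; rewrite -subr_eq0; apply/eqP/enorm_eq0/eqP.
  rewrite eq_le enorm_ge0 andbT.
  (* Inserting [v k.+1 = T (v k)] bounds [enorm (T l - l)] by this sequence, which tends to 0. *)
  have : kappa * enorm (v k - l) + enorm (v k.+1 - l) @[k --> \oo] --> kappa * 0 + 0.
    apply: cvgD; first by apply: cvgM => //; exact: cvg_cst.
    by rewrite -(cvg_shiftS) in vl0.
  rewrite mulr0 addr0 => cvg0.
  apply: (cvgr_to_ge cvg0).
  near=> k; rewrite -(subrKA (v k.+1)); apply: le_trans (enormD _ _) _.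
  rewrite lerD// enorm_distC; apply: Tlip; exact: ball_U.
have fixE y : f y = 0 <-> T y = y.
  split=> [fy|/eqP]; first by rewrite /T fy mulmx0 subr0.
  rewrite -subr_eq0 /T addrAC subrr add0r oppr_eq0 => /eqP fy.
  by rewrite -[f y](mulKVmx M_inv) fy mulmx0.
exists l; split=> //.
(* Dropping the first [n] terms, which include the dummy values, preserves the limit. *)
- rewrite -(cvg_shiftn n) /=; rewrite (_ : (fun _ => _) = v)//.
  by apply/funext => k; rewrite /u /simplified_newton addnK.
- exact/fixE.
- move=> y By /fixE Ty; apply/eqP; rewrite -subr_eq0; apply/eqP/enorm_eq0/eqP.
  rewrite eq_le enorm_ge0 andbT.
  (* Two fixed points satisfy [(1 - kappa) * enorm (y - l) <= 0], and [1 - kappa] is positive. *)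
  have := Tlip _ _ (ball_U _ By) (ball_U _ Bl); rewrite Ty Tl.
  rewrite -subr_le0 -{1}[enorm _]mul1r -mulrBl.
  by rewrite pmulr_rle0 ?subr_gt0.
Unshelve. all: by end_near. Qed.
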